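(* For all integers $3 \le t \le k$ there exists $c=c(k)$ such that for all integers $n>k+1$, $r_k(k+1, t; P_n) < \mathrm{twr}_{t-2}(c\,n^{2k})$.
   Context: For $k\ge 2$, the $k$-uniform tight path $P_n$ has vertices $v_1<\cdots<v_n$ and edges $\{v_j,\dots,v_{j+k-1}\}$ for $j=1,\dots,n-k+1$; in a red/blue coloring of the $k$-subsets of $[N]$, a blue copy of $P_n$ is a sequence $x_1<\cdots<x_n$ in $[N]$ with every $k$-set $\{x_j,\dots,x_{j+k-1}\}$ blue. For integers $2\le k<s<n$ and $1\le t\le\binom{s}{k}$, $r_k(s,t;P_n)$ is the minimum $N$ such that every red/blue coloring of the $k$-subsets of $[N]$ contains a blue copy of $P_n$ or a set of $s$ vertices containing at least $t$ red $k$-subsets. The tower function: $\mathrm{twr}_1(x)=x$, $\mathrm{twr}_{i+1}(x)=2^{\mathrm{twr}_i(x)}$. *)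

(* Defs.v *)
From mathcomp Require Import all_boot.
Set Implicit Arguments.
Unset Strict Implicit.
Unset Printing Implicit Defensive.

(* A red/blue coloring of the k-subsets of [N] (encoded as 'I_N) is a predicate
   on {set 'I_N}: [true] is red, [false] is blue. Its values on sets whose
   cardinality is not k are never inspected below. *)
Definition coloring (N : nat) := {set 'I_N} -> bool.

(* The vertices v_1 < ... < v_n are indexed from 0, so that the edges are the
   windows {x_j, ..., x_(j+k-1)} with 0 <= j <= n - k. *)
Definition blue_tight_path (k n N : nat) (red : coloring N)
    (x : 'I_n -> 'I_N) : Prop :=
  (forall i j : 'I_n, i < j -> x i < x j) /\
  (forall j : nat, j + k <= n ->
     ~~ red [set x i | i : 'I_n & j <= i < j + k]).

Definition red_edges (k N : nat) (red : coloring N) (S : {set 'I_N}) :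
    {set {set 'I_N}} :=
  [set e : {set 'I_N} | [&& e \subset S, #|e| == k & red e]].

Definition ramsey_prop (k s t n N : nat) : Prop :=
  forall red : coloring N,
    (exists x : 'I_n -> 'I_N, blue_tight_path k red x) \/
    (exists S : {set 'I_N}, #|S| = s /\ t <= #|red_edges k red S|).

(* [is_ramsey_number k s t n r] reads "r_k(s, t; P_n) = r"; in particular it
   asserts that the minimum exists. *)
Definition is_ramsey_number (k s t n r : nat) : Prop :=
  ramsey_prop k s t n r /\
  (forall N : nat, ramsey_prop k s t n N -> r <= N).

(* Indexed from 1: twr 1 x = x and twr i.+2 x = 2 ^ twr i.+1 x. The index 0 is
   a junk value (twr 0 x = x). *)
Definition twr (i x : nat) : nat := iter i.-1 (expn 2) x.

(* Main.v *)
(* For t = 3 a quadratic number of vertices suffices, whatever k >= 3. Say that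
   a (k-1)-tuple has level m if it ends a blue tight path with m additional
   vertices. If a (k-2)-tuple v has extensions a < a_1 < ... < a_d to tuples of
   level m and every va a_j is blue, then the (k-2)-tuple (v minus its first
   vertex) a has d extensions of level m + 1; so if few such extensions exist
   then some edge va b is red. Likewise va y and vb y are both red for all but
   few later y, and va b y contains three red edges. Hence, going down from
   the top level to level 0, the maximal number of extensions grows by only one
   at each level, provided that 2i + 1 final vertices are discarded at step i.
   The passage from (k, t) to (k+1, t+1) costs one exponential: on an
   Erdos-Rado sequence the color of an edge does not depend on its last vertex,
   which defines a coloring of the k-sets; adding a last vertex to a set with t
   red k-subsets gives a set with t + 1 red (k+1)-subsets, provided that its
   initial k-subset was among the red ones. *)

Require Import Defs.
From mathcomp Require Import all_boot.
From mathcomp Require Import zify.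
From Stdlib Require Import Classical.

Set Implicit Arguments.
Unset Strict Implicit.
Unset Printing Implicit Defensive.

(** * Colorings of increasing sequences of natural numbers *)

Definition increasing_in (X x : seq nat) := sorted ltn x && all [in X] x.

Definition blue_windows (k : nat) (red : pred (seq nat)) (x : seq nat) :=
  forall j, j + k <= size x -> ~~ red (take k (drop j x)).

Definition has_blue_path (k n : nat) (red : pred (seq nat)) (X : seq nat) :=
  exists x, [/\ increasing_in X x, size x = n & blue_windows k red x].

Definition omit (z : nat) (s : seq nat) := [seq y <- s | y != z].

(* Requiring the edge that omits the last vertex to be red is what lets the
   count of red edges grow by one in [stepping_up]. *)
Definition has_red_cluster (k t : nat) (red : pred (seq nat)) (X : seq nat) :=
  exists s w, [/\ increasing_in X (rcons s w), size s = k, red s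
    & t <= count (fun z => red (omit z (rcons s w))) (rcons s w)].

(** Quantifying over every increasing [X], not just an initial segment, lets the property be applied
    to extracted subsequences. *)
Definition unavoidable (k t n F : nat) :=
  forall red X, sorted ltn X -> F <= size X ->
    has_blue_path k n red X \/ has_red_cluster k t red X.

Lemma increasing_in_sub (X Y x : seq nat) :
  {subset X <= Y} -> increasing_in X x -> increasing_in Y x.
Proof. by move=> sXY /andP[sx /allP xX]; apply/andP; split=> //; apply/allP => y /xX /sXY. Qed.

Lemma sorted_prefix (s : seq nat) (a : nat) : sorted ltn (rcons s a) -> sorted ltn s.
Proof. by rewrite -cats1 => /cat_sorted2[]. Qed.

Lemma sorted_rcons2 (s : seq nat) (a b : nat) :
  sorted ltn (rcons s a) -> a < b -> sorted ltn (rcons (rcons s a) b).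
Proof.
case: s => [|c s] /=; first by rewrite andbT.
by move=> sa ab; rewrite rcons_path last_rcons sa.
Qed.

Lemma ltn_sorted_rcons (s : seq nat) (a x : nat) :
  sorted ltn (rcons s a) -> x \in s -> x < a.
Proof.
rewrite -cats1 (sorted_pairwise ltn_trans) pairwise_cat => /and3P[/allrelP h _ _] xs.
by apply: h xs _; rewrite inE.
Qed.

Lemma omit_id (z : nat) (s : seq nat) : z \notin s -> omit z s = s.
Proof.
by move=> zs; apply/all_filterP/allP => y ys; apply: contraNneq zs => <-.
Qed.

Lemma omit_last (s : seq nat) (w : nat) :
  sorted ltn (rcons s w) -> omit w (rcons s w) = s.
Proof.
move=> sw; rewrite /omit filter_rcons eqxx /= -/(omit w s) omit_id //.
by apply/negP => /(ltn_sorted_rcons sw); rewrite ltnn.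
Qed.

(** * Levels of blue tight paths and the case of three red edges *)

(* The vertices [q] preceding the last k - 1 vertices [u] of a blue path. *)
Definition reaches (k m : nat) (red : pred (seq nat)) (X u : seq nat) :=
  exists q, [/\ size q = m, increasing_in X (q ++ u) & blue_windows k red (q ++ u)].

Lemma blue_windows_rcons (k : nat) (red : pred (seq nat)) (q u : seq nat) (y : nat) :
  (size u).+1 = k -> blue_windows k red (q ++ u) -> ~~ red (rcons u y) ->
  blue_windows k red (rcons (q ++ u) y).
Proof.
move=> uk bw ry j; rewrite size_rcons leq_eqVlt => /orP[/eqP jk|jk].
  (* The only new window starts right after [q] and equals [rcons u y]. *)
  have -> : j = size q by move: jk; rewrite size_cat; lia.
  by rewrite rcons_cat drop_size_cat // take_oversize // size_rcons uk.
have jk' : j + k <= size (q ++ u) by lia.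
rewrite -cats1 drop_cat ifT; last by lia.
by rewrite takel_cat ?bw // size_drop; lia.
Qed.

(** Appending [y] pushes [c] out of the last k - 1 vertices into the preceding ones, which raises
    the level by one. *)
Lemma reaches_extend (k m : nat) (red : pred (seq nat)) (X v : seq nat) (c a y : nat) :
  (size v).+3 = k -> reaches k m red X (rcons (c :: v) a) -> a < y -> y \in X ->
  ~~ red (rcons (rcons (c :: v) a) y) ->
  reaches k m.+1 red X (rcons (rcons v a) y).
Proof.
move=> vk [q [qm /andP[sq aq] bq]] ay yX ry.
exists (rcons q c).
have E : rcons q c ++ rcons (rcons v a) y = rcons (q ++ rcons (c :: v) a) y.
  by rewrite cat_rcons rcons_cat /= .
rewrite E size_rcons qm; split=> //.
  rewrite /increasing_in all_rcons yX aq andbT.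
  by rewrite -rcons_cat sorted_rcons2 ?rcons_cat.
by apply: blue_windows_rcons => //; rewrite size_rcons.
Qed.

(** The three red edges arise by omitting [y], [b] and [a]; the first of them is the initial edge
    that a cluster requires. *)
Lemma red_cluster3 (k : nat) (red : pred (seq nat)) (X v : seq nat) (a b y : nat) :
  increasing_in X (rcons (rcons (rcons v a) b) y) -> (size v).+2 = k ->
  red (rcons (rcons v a) b) -> red (rcons (rcons v a) y) ->
  red (rcons (rcons v b) y) -> has_red_cluster k 3 red X.
Proof.
move=> inc vk rab ray rby; exists (rcons (rcons v a) b), y.
split=> //; first by rewrite !size_rcons.
have /andP[srt _] := inc.
have sab := sorted_prefix srt; have sa := sorted_prefix sab.
have ab : a < b by apply: (ltn_sorted_rcons sab); rewrite mem_rcons inE eqxx.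
have by_ : b < y by apply: (ltn_sorted_rcons srt); rewrite mem_rcons inE eqxx.
have e1 : omit y (rcons (rcons (rcons v a) b) y) = rcons (rcons v a) b by apply: omit_last.
have e2 : omit b (rcons (rcons (rcons v a) b) y) = rcons (rcons v a) y.
  by rewrite /omit filter_rcons (gtn_eqF by_) /= -/(omit b _) omit_last.
have e3 : omit a (rcons (rcons (rcons v a) b) y) = rcons (rcons v b) y.
  rewrite /omit 2!filter_rcons (gtn_eqF ab) (gtn_eqF (ltn_trans ab by_)) /=.
  by rewrite -/(omit a _) omit_last.
set P := (X in count X).
have [Pa Pb Py] : [/\ P a, P b & P y] by rewrite /P e1 e2 e3.
by rewrite -!cats1 !count_cat /= Pa Pb Py !addn0 !addn1.
Qed.

Lemma mem_take_drop_lt (X : seq nat) (i j a y : nat) :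
  sorted ltn X -> i <= j -> a \in take i X -> y \in drop j X -> a < y.
Proof.
move=> sX ij aX yX.
have : pairwise ltn (take j X ++ drop j X) by rewrite cat_take_drop -(sorted_pairwise ltn_trans).
rewrite pairwise_cat => /and3P[/allrelP h _ _]; apply: h => //.
by move: aX; rewrite -(take_takel X ij); exact: mem_take.
Qed.

(** Here k = p + 2, and [i] counts levels down from the top level n - p - 1. The cut at i^2 = 1 + 3
    + ... + (2i - 1) adds up the final vertices discarded so far. *)
Lemma few_extensions (p n : nat) (red : pred (seq nat)) (X : seq nat) :
  0 < p -> p < n -> sorted ltn X ->
  ~ has_blue_path p.+2 n red X -> ~ has_red_cluster p.+2 3 red X ->
  forall i, i < n - p -> forall v A, size v = p -> sorted ltn A ->
    {in A, forall a, a \in take (size X - i ^ 2) X /\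
       reaches p.+2 (n - p.+1 - i) red X (rcons v a)} ->
    size A <= i.
Proof.
move=> p0 pn sX noblue nored; elim=> [|i IH] ip v A vp sA hA.
  (* At the top level one extension already completes a blue path with [n] vertices. *)
  case: A sA hA => // a A _ /(_ a (mem_head _ _))[_ [q [qm inc bw]]].
  case: noblue; exists (q ++ rcons v a); split=> //.
  by rewrite size_cat size_rcons vp qm; lia.
rewrite leqNgt; apply/negP; case: A sA hA => // a A sA hA Ai.
case: v vp hA => [|c v] vp hA; first by rewrite -vp in p0.
have {}IH := IH (ltnW ip).
have Em : n - p.+1 - i = (n - p.+1 - i.+1).+1 by lia.
have [aX aR] := hA a (mem_head _ _).
have ext x y : x < y -> y \in X ->
    reaches p.+2 (n - p.+1 - i.+1) red X (rcons (c :: v) x) ->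
    ~~ red (rcons (rcons (c :: v) x) y) ->
    reaches p.+2 (n - p.+1 - i) red X (rcons (rcons v x) y).
  by move=> xy yX xR xB; rewrite Em; apply: (@reaches_extend _ _ _ _ _ c) => //=; rewrite -vp.
have szv x : size (rcons v x) = p by rewrite size_rcons.
have sub_i x : x \in take (size X - i.+1 ^ 2) X -> x \in take (size X - i ^ 2) X.
  have le : size X - i.+1 ^ 2 <= size X - i ^ 2 by lia.
  by rewrite -(take_takel X le); exact: mem_take.
have ltA x : x \in A -> a < x.
  by move: sA; rewrite /= (path_sortedE ltn_trans) => /andP[/allP + _]; exact.
have sA' : sorted ltn A by move: sA; rewrite /=; exact: path_sorted.
(* Otherwise all of [A], more than [i] vertices, would extend [rcons v a] one level up, against the
   induction hypothesis. *)
have [b bA rb] : exists2 b, b \in A & red (rcons (rcons (c :: v) a) b).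
  apply/hasP; apply/negPn/negP => /hasPn nr.
  suff: size A <= i by rewrite leqNgt -ltnS Ai.
  apply: (IH (rcons v a) A (szv _) sA') => x xA.
  have [xX _] := hA x (mem_behead (s := a :: A) xA).
  by split; [exact: sub_i|apply: ext; rewrite ?ltA ?(mem_take xX) ?nr].
have [bX bR] := hA b (mem_behead (s := a :: A) bA).
have ab := ltA _ bA.
(* The block newly discarded at this step; it lies after [a] and [b]. *)
set D := drop (size X - i.+1 ^ 2) (take (size X - i ^ 2) X).
have sD : sorted ltn D by apply: drop_sorted; apply: take_sorted.
have DX x : x \in D -> x \in take (size X - i ^ 2) X by exact: mem_drop.
have Dlt x y : x \in take (size X - i.+1 ^ 2) X -> y \in D -> x < y.
  move=> xX yD; apply: (@mem_take_drop_lt (take (size X - i ^ 2) X)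
    (size X - i.+1 ^ 2) (size X - i.+1 ^ 2)) => //.
    exact: take_sorted.
  by rewrite take_takel // leq_sub2l // leq_sqr.
have few x : x \in take (size X - i.+1 ^ 2) X ->
    reaches p.+2 (n - p.+1 - i.+1) red X (rcons (c :: v) x) ->
    count (fun y => ~~ red (rcons (rcons (c :: v) x) y)) D <= i.
  move=> xX xR; rewrite -size_filter; apply: (IH (rcons v x)) => //.
    exact: sorted_filter ltn_trans _ _ sD.
  move=> y; rewrite mem_filter => /andP[yr yD]; split; first exact: DX.
  by apply: ext => //; [exact: Dlt|exact: mem_take (DX _ yD)].
(* The presence of [a] before the cut excludes truncated subtraction, so [D] has its full 2i + 1
   vertices. *)
have szX : i.+1 ^ 2 < size X.
  by rewrite ltnNge -subn_eq0; apply/negP => /eqP e; move: aX; rewrite e take0.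
have szD : size D = i.*2.+1.
  have e2 : i.+1 ^ 2 = i ^ 2 + i.*2.+1 by rewrite -[i.+1]addn1 sqrnD muln1 mul2n -addnA add1n.
  rewrite size_drop size_takel ?leq_subr //; move: szX; rewrite e2; move: (i ^ 2) => s.
  by clear; lia.
(* At most [i] vertices of [D] give a blue edge with [a], and at most [i] with [b]. *)
have [y yD] : exists2 y, y \in D &
    red (rcons (rcons (c :: v) a) y) && red (rcons (rcons (c :: v) b) y).
  apply/hasP; rewrite has_count -subn_gt0 subn0.
  have := count_predC (fun y => red (rcons (rcons (c :: v) a) y) && red (rcons (rcons (c :: v) b) y)) D.
  have := few a aX aR; have := few b bX bR.
  have := count_predUI (fun y => ~~ red (rcons (rcons (c :: v) a) y))
    (fun y => ~~ red (rcons (rcons (c :: v) b) y)) D.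
  set C := count (predI _ _) D; rewrite (@eq_count _ (predU _ _) (predC (fun y =>
    red (rcons (rcons (c :: v) a) y) && red (rcons (rcons (c :: v) b) y)))); last first.
    by move=> z /=; rewrite negb_and.
  by rewrite szD; clear; lia.
case/andP=> ray rby; apply: nored.
apply: (@red_cluster3 _ _ _ (c :: v) a b y) => //; last by rewrite vp.
have by_ := Dlt _ _ bX yD.
case: aR => q [_ /andP[sq allq] _].
move: sq => /cat_sorted2[_ sva]; move: allq; rewrite all_cat => /andP[_ allva].
apply/andP; split; first by do 2! apply: sorted_rcons2 => //.
rewrite 2!all_rcons allva /= andbT.
by rewrite (mem_take (DX _ yD)) (mem_take bX).
Qed.

(** A tuple of k - 1 vertices contains no window, so every increasing one has level 0. Taking the
    first [p] vertices of [X] as [v], all vertices from there up to the cut are extensions, which is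
    too many. *)
Lemma unavoidable3 (p n : nat) : 0 < p -> p < n -> unavoidable p.+2 3 n (n ^ 2).
Proof.
move=> p0 pn red X sX nX; apply: NNPP => /not_or_and[nb nr].
set i := n - p.+1; set M := size X - i ^ 2.
have iE : n = i + p.+1 by rewrite /i; lia.
(* Expanding n^2 = (i + (p + 1))^2 leaves at least (p + 1)^2 + 2i(p + 1) vertices before the cut. *)
have pM : p + i < M.
  rewrite ltn_subRL (leq_trans _ nX) // iE sqrnD -addnA ltn_add2l.
  have := leq_pmulr i (ltn0Sn p); have := leq_pmulr p.+1 (ltn0Sn p).
  by rewrite mulnn; lia.
have leM : M <= size X by rewrite leq_subr.
have szp : size (take p X) = p by apply: size_takel; lia.
have sA : sorted ltn (drop p (take M X)) by apply/drop_sorted/take_sorted.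
have ip : i < n - p by rewrite iE; lia.
have := few_extensions p0 pn sX nb nr ip szp sA.
rewrite size_drop size_takel // => h; suff: M - p <= i by lia.
apply: h => a aA; have aM := mem_drop aA; split=> //.
rewrite subnn; exists [::]; split=> //=.
  have aX : a \in drop p X.
    have pleM : p <= M by lia.
    by move: aA; rewrite -(subnK pleM) -take_drop; exact: mem_take.
  rewrite /increasing_in all_rcons (mem_take aM); apply/andP; split; last first.
    by apply/allP => x /mem_take.
  rewrite -cats1 (sorted_pairwise ltn_trans) pairwise_cat /= andbT.
  rewrite -(sorted_pairwise ltn_trans) take_sorted // andbT.
  by apply/allrelP => x y xp; rewrite inE => /eqP ->; exact: mem_take_drop_lt sX (leqnn p) xp aX.
by move=> j; rewrite size_rcons szp; lia.
Qed.

(** * Erdos-Rado sequences *)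

Fixpoint words (Y : seq nat) (r : nat) : seq (seq nat) :=
  if r is r'.+1 then [seq rcons w y | w <- words Y r', y <- Y] else [:: [::]].

Lemma size_words (Y : seq nat) (r : nat) : size (words Y r) = size Y ^ r.
Proof. by elim: r => //= r IH; rewrite size_allpairs IH expnSr. Qed.

Lemma mem_words (Y w : seq nat) : all [in Y] w -> w \in words Y (size w).
Proof.
elim/last_ind: w => [|w y IH] //; rewrite all_rcons size_rcons => /andP[yY wY] /=.
by apply/allpairsP; exists (w, y); rewrite IH.
Qed.

(** Iterated pigeonhole: one of the two classes of [P w] retains half of the guaranteed length, so
    each [w] costs a factor of two. *)
Lemma homogeneous_subseq (W : eqType) (P : W -> pred nat) (ws : seq W)
    (Z : seq nat) (q : nat) :
  2 ^ size ws * q <= size Z ->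
  exists Z', [/\ subseq Z' Z, q <= size Z' &
    forall w, w \in ws -> {in Z' &, forall x y, P w x = P w y}].
Proof.
elim: ws Z => [|w ws IH] Z /= hZ; first by exists Z; rewrite mul1n in hZ.
have [b hb] : exists b, 2 ^ size ws * q <= size [seq x <- Z | P w x == b].
  have := count_predC (P w) Z; rewrite -!size_filter.
  move: hZ; rewrite expnS -mulnA; set c := 2 ^ _ * q => hZ hc.
  have [h|h] := leqP c (size (filter (P w) Z)).
    by exists true; rewrite (eq_filter (a2 := P w)) // => x; rewrite eqb_id.
  exists false; rewrite (eq_filter (a2 := predC (P w))); first by lia.
  by move=> x; rewrite /= eqbF_neg.
have [Z' [sub qZ' hom]] := IH _ hb.
exists Z'; split=> //; first exact: subseq_trans sub (filter_subseq _ _).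
have PZ x : x \in Z' -> P w x = b.
  by move=> /(mem_subseq sub); rewrite mem_filter => /andP[/eqP].
move=> u; rewrite inE => /orP[/eqP->|/hom //] x y xZ yZ.
by rewrite !PZ.
Qed.

Definition end_homogeneous (r : nat) (red : pred (seq nat)) (Y Z : seq nat) :=
  forall e y y', size e = r -> all [in Y] e -> y \in Z -> y' \in Z ->
    sorted ltn (rcons e y) -> sorted ltn (rcons e y') ->
    red (rcons e y) = red (rcons e y').

(** Greedy construction: [Y] is the part already chosen, [Z] the reservoir, [j] the number of
    vertices still to choose. The head [z] of [Z] joins [Y], and [Z] is thinned until the color of
    each edge [rcons (rcons w z) x] no longer depends on [x]; there are at most m^r words [w]. *)
Lemma erdos_rado (r m : nat) (red : pred (seq nat)) j Y Z :
  size Y + j = m -> sorted ltn (Y ++ Z) ->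
  end_homogeneous r.+1 red Y (Y ++ Z) ->
  2 ^ ((m ^ r + 1) * j) <= size Z ->
  exists Y' w, [/\ size Y' = m, sorted ltn (rcons Y' w),
    {subset rcons Y' w <= Y ++ Z} & end_homogeneous r.+1 red Y' (rcons Y' w)].
Proof.
elim: j Y Z => [|j IH] Y [|z Z] Ym sYZ hom; rewrite ?leqn0 ?expn_eq0 //= => hZ.
  (* When [j] is 0 the reservoir is still nonempty, and its head serves as the final vertex [w]. *)
  have sub : {subset rcons Y z <= Y ++ z :: Z}.
    by move=> x; rewrite -cats1 !mem_cat !inE orbA => ->.
  exists Y, z; split=> //; first by rewrite -Ym addn0.
    by move: sYZ; rewrite -cat_rcons => /cat_sorted2[].
  by move=> e y y' er eY /sub yZ /sub y'Z; exact: hom.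
have sYz : sorted ltn (rcons Y z) by move: sYZ; rewrite -cat_rcons => /cat_sorted2[].
have [|Z2 [sub hZ2 homZ]] := @homogeneous_subseq _ (fun w x => red (rcons (rcons w z) x))
    (words Y r) Z (2 ^ ((m ^ r + 1) * j)).
  rewrite size_words.
  have le : size Y ^ r <= m ^ r by case: (r) => // r'; rewrite leq_exp2r // -Ym leq_addr.
  have le2 : 2 ^ (size Y ^ r) <= 2 ^ (m ^ r) by rewrite leq_exp2l.
  apply: (leq_trans (leq_mul le2 (leqnn _))).
  (* The [+ 1] in the exponent gives a spare factor of two, which pays for the removal of [z]. *)
  move: hZ; rewrite mulnS !expnD expn1 (mulnC (_ ^ _) 2) -mulnA.
  have : 0 < 2 ^ (m ^ r) * 2 ^ ((m ^ r + 1) * j) by rewrite muln_gt0 !expn_gt0.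
  by set c := (_ * _); clearbody c; clear; lia.
have subs : subseq (rcons Y z ++ Z2) (Y ++ z :: Z).
  by rewrite cat_rcons; apply: cat_subseq => //=; rewrite eqxx.
have [||||Y' [w [Y'm sY' sub' hom']]] := IH (rcons Y z) Z2 => //.
- by rewrite size_rcons addSnnS.
- exact: (subseq_sorted ltn_trans subs sYZ).
- move=> e y y' er eYz yZ y'Z sy sy'.
  have eY : all [in Y] [seq x <- e | x != z].
    apply/allP => x; rewrite mem_filter => /andP[xz /(allP eYz)].
    by rewrite /= mem_rcons inE (negPf xz).
  have [ze|ze] := boolP (z \in e); last first.
    by rewrite -/(omit z e) omit_id // in eY; apply: hom => //; exact: (mem_subseq subs).
  (* Since [z] exceeds all of [Y], it must be the last vertex of [e]; then [y] and [y'] lie in [Z2],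
     where the thinning applies. *)
  case/lastP: e => [|u x] in er eYz sy sy' eY ze *; first by [].
  have xz : x = z.
    move: ze; rewrite mem_rcons inE => /orP[/eqP //|zu].
    have := allP eYz x; rewrite /= !mem_rcons !inE eqxx => /(_ isT) /orP[/eqP //|xY].
    have := ltn_sorted_rcons (sorted_prefix sy) zu.
    by rewrite ltnNge ltnW // (ltn_sorted_rcons sYz xY).
  rewrite {x}xz in er eYz sy sy' eY ze *.
  rewrite -/(omit _ _) (omit_last (sorted_prefix sy)) in eY.
  have inZ2 x : x \in rcons Y z ++ Z2 -> sorted ltn (rcons (rcons u z) x) -> x \in Z2.
    rewrite mem_cat mem_rcons inE => + sx.
    have zx : z < x by apply: (ltn_sorted_rcons sx); rewrite mem_rcons inE eqxx.
    rewrite (gtn_eqF zx) /= => /orP[xY|//].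
    by have := ltn_trans zx (ltn_sorted_rcons sYz xY); rewrite ltnn.
  rewrite size_rcons in er; case: er => er.
  by apply: (homZ u); rewrite ?inZ2 // -er mem_words.
exists Y', w; split=> //.
by move=> x /sub' /(mem_subseq subs).
Qed.

(** * Raising the uniformity and the number of red edges by one *)

Lemma stepping_up (r t n F : nat) :
  unavoidable r.+1 t n F -> unavoidable r.+2 t.+1 n (2 ^ ((F ^ r + 1) * F)).
Proof.
move=> unF red X sX hX.
have [||||Y [w [YF sYw subX hom]]] := @erdos_rado r F red F [::] X => //.
  by move=> [].
have sY := sorted_prefix sYw.
have YX : {subset Y <= X} by move=> x xY; apply: subX; rewrite mem_rcons inE xY orbT.
have Yw x : x \in Y -> x < w by exact: ltn_sorted_rcons.
have snoc e : increasing_in Y e -> sorted ltn (rcons e w).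
  case/andP=> se eY; rewrite -cats1 (sorted_pairwise ltn_trans) pairwise_cat.
  rewrite -(sorted_pairwise ltn_trans) se /= !andbT.
  by apply/allrelP => x y /(allP eY) xY; rewrite inE => /eqP ->; exact: Yw.
have redE e y : size e = r.+1 -> increasing_in Y (rcons e y) ->
    red (rcons e y) = red (rcons e w).
  move=> er /andP[sey]; rewrite all_rcons => /andP[yY eY].
  apply: hom => //; rewrite ?mem_rcons ?inE ?eqxx ?(yY : y \in Y) ?orbT //.
  by apply: snoc; rewrite /increasing_in (sorted_prefix sey).
have [|[x [xinc xn xblue]]|[s [v [inc sr reds cnt]]]] :=
    unF (fun e => red (rcons e w)) Y sY; first by rewrite YF.
  left; exists x; split=> //; first exact: increasing_in_sub xinc.
  move=> j jx; have jx' : j + r.+1 <= size x by lia.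
  have lt : r.+1 < size (drop j x) by rewrite size_drop; lia.
  (* Replacing the last vertex of the window by [w] keeps its color and yields the derived color of
     its first r + 1 vertices. *)
  rewrite (take_nth 0 lt) redE; first exact: xblue.
    by rewrite size_takel // ltnW.
  rewrite -take_nth //; case/andP: xinc => sx xY; apply/andP; split.
    by apply/take_sorted/drop_sorted.
  by apply/allP => y /mem_take /mem_drop /(allP xY).
right; exists (rcons s v), w; have wS z : z \in rcons s v -> w != z.
  by case/andP: inc => _ /allP h /h /Yw lt; rewrite gtn_eqF.
split.
- apply/andP; split; first exact: snoc.
  rewrite all_rcons /= subX ?mem_rcons ?inE ?eqxx //=.
  by apply/allP => y; case/andP: inc => _ /allP h /h /YX.
- by rewrite size_rcons sr.
- by rewrite redE.
(* Omitting [w] yields the additional red edge, as [rcons s v] has the color of [rcons s w].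
   Omitting any other vertex keeps [w] last, so the derived count carries over. *)
rewrite -[X in count _ X]cats1 count_cat /= omit_last; last exact: snoc.
rewrite redE // reds addn0 addn1 ltnS (leq_trans cnt) //.
rewrite leq_eqVlt; apply/orP; left; apply/eqP; apply: eq_in_count => z zS /=.
by rewrite [in RHS]/omit filter_rcons wS.
Qed.

(** * Tower estimates *)

Lemma unavoidable_le (k t n F G : nat) :
  F <= G -> unavoidable k t n F -> unavoidable k t n G.
Proof. by move=> FG uF red X sX GX; apply: uF => //; exact: leq_trans GX. Qed.

Lemma leq_twr (i x y : nat) : x <= y -> twr i.+1 x <= twr i.+1 y.
Proof.
by move=> xy; elim: i => // i IH; rewrite /twr !iterS leq_exp2l.
Qed.

Lemma ltn_twr (i x y : nat) : x < y -> twr i.+1 x < twr i.+1 y.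
Proof.
by move=> xy; elim: i => // i IH; rewrite /twr !iterS ltn_exp2l.
Qed.

(** A factor moves inside one exponential because a + 1 <= 2^a and a + z <= (a + 1)z for positive
    z. *)
Lemma leq_mul_twr (a i x : nat) : 0 < x -> a.+1 * twr i.+1 x <= twr i.+1 (a.+1 * x).
Proof.
move=> x0; elim: i => [|i IH]; first by [].
have z0 : 0 < twr i.+1 x by case: (i) => // j; rewrite /twr iterS expn_gt0.
change (a.+1 * 2 ^ twr i.+1 x <= 2 ^ twr i.+1 (a.+1 * x)).
apply: (@leq_trans (2 ^ (a + twr i.+1 x))).
  by rewrite expnD leq_mul2r ltn_expl // orbT.
rewrite leq_exp2l // (leq_trans _ IH) // mulSn addnC leq_add2l.
exact: leq_pmulr.
Qed.

(** Each stepping up multiplies the innermost argument by at most the current uniformity. The fixed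
    bound [K] on all uniformities makes these factors accumulate to K^i. *)
Lemma tower_bound (K i p n : nat) :
  0 < p -> p < n -> p + i.+3 <= K ->
  unavoidable (p + i.+3) i.+4 n (twr i.+2 (2 * K ^ i * n ^ (2 * (p + i.+2)))).
Proof.
move=> p0 pn; have n0 : 0 < n by apply: leq_trans pn.
have sum_le F r : 0 < F -> (F ^ r + 1) * F <= 2 * F ^ r.+1.
  by move=> F0; rewrite mulnDl mul1n -expnSr mul2n -addnn leq_add2l expnSr leq_pmull // expn_gt0 F0.
elim: i => [|i IH] pK.
  rewrite addn3; apply: unavoidable_le (stepping_up (unavoidable3 p0 pn)).
  rewrite muln1; set y := 2 * _; have -> : twr 2 y = 2 ^ y by [].
  by rewrite leq_exp2l // /y expnM addn2 sum_le // expn_gt0 n0.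
have K0 : 0 < K by lia.
have pK' : p + i.+3 <= K by lia.
have [r Er] : exists r, r = p + i.+2 by exists (p + i.+2).
have E1 : p + i.+3 = r.+1 by rewrite Er addnS.
have E2 : p + i.+4 = r.+2 by rewrite -E1 addnS.
rewrite E2 in pK *; have {IH} := IH pK'; rewrite !E1 -Er => {E1 E2 Er pK'}.
set x := 2 * K ^ i * _.
have x0 : 0 < x by rewrite !muln_gt0 !expn_gt0 K0 n0.
move=> uF; apply: unavoidable_le (stepping_up uF).
set z := twr i.+1 x; have -> : twr i.+2 x = 2 ^ z by [].
set y := 2 * K ^ i.+1 * _; have -> : twr i.+3 y = 2 ^ (2 ^ twr i.+1 y) by [].
have z0 : 0 < z by rewrite /z; case: (i) => // j; rewrite /twr iterS expn_gt0.
rewrite leq_exp2l // (leq_trans (sum_le _ _ _)) ?expn_gt0 // -expnM -expnS leq_exp2l //.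
(* With F = 2^z, 2F^(r+1) is 2 to the power 1 + (r + 1)z, and 1 <= z. *)
apply: (@leq_trans (r.+2 * z)); first by rewrite (mulSn r.+1) (mulnC z); exact: (leq_add z0 (leqnn _)).
apply: leq_trans (leq_mul_twr _ _ x0) (leq_twr _ _).
rewrite /x /y expnS mulnA (mulnCA r.+2) leq_mul //.
  by rewrite leq_mul2l leq_mul2r pK orbT.
by rewrite leq_pexp2l // leq_mul2l leqnSn.
Qed.

(** * Return to colorings of k-subsets *)

Definition vertices_in (N : nat) (s : seq nat) : {set 'I_N} :=
  [set y : 'I_N | val y \in s].

Lemma card_vertices_in (N : nat) (s : seq nat) :
  uniq s -> all [in iota 0 N] s -> #|vertices_in N s| = size s.
Proof.
move=> us /allP sN.
have E : map val (pmap (insub : nat -> option 'I_N) s) = s.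
  rewrite (pmap_filter (insubK _)); apply/all_filterP/allP => x /sN /=.
  by rewrite mem_iota add0n => xN; rewrite insubT.
move: us; rewrite -{1 3}E size_map (map_inj_uniq val_inj) => /card_uniqP <-.
by apply: eq_card => y; rewrite inE -{1}E (mem_map val_inj).
Qed.

Lemma size_omit (z : nat) (s : seq nat) :
  uniq s -> z \in s -> size (omit z s) = (size s).-1.
Proof. by move=> us zs; rewrite -(size_rem zs) rem_filter. Qed.

(** A sequence receives the color of its vertex set, and [X] is the list of all vertices. *)
Lemma ramsey_prop_of_unavoidable (k t n N : nat) :
  unavoidable k t n N -> ramsey_prop k (k + 1) t n N.
Proof.
move=> uN red.
have [|[x [/andP[sx xN] xn bx]]|[s [w [/andP[sL LN] sk _ cnt]]]] :=
    uN (fun s => red (vertices_in N s)) (iota 0 N) (iota_ltn_sorted 0 N).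
- by rewrite size_iota.
- left.
  have lt (i : 'I_n) : nth 0 x i < N.
    have : nth 0 x i \in x by rewrite mem_nth // xn.
    by move/(allP xN); rewrite /= mem_iota.
  exists (fun i => Ordinal (lt i)); split=> [i j ij|j jn].
    by rewrite /= (sorted_ltn_nth ltn_trans) ?inE ?xn.
  rewrite -[X in red X](_ : vertices_in N (take k (drop j x)) = _) ?bx ?xn //.
  apply/setP => y; rewrite inE; apply/(nthP 0)/imsetP.
    move=> [a]; rewrite size_take size_drop xn => ha.
    have {}ha : a < k by move: ha; case: ifP; lia.
    have aj : j + a < n by lia.
    rewrite nth_take // nth_drop => E; exists (Ordinal aj); last exact/val_inj.
    by rewrite inE /=; lia.
  move=> [i]; rewrite inE => /andP[ji ijk] ->; exists (i - j).
    by rewrite size_take size_drop xn; have := ltn_ord i; case: ifP; lia.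
  by rewrite nth_take ?nth_drop /= ?subnKC //; lia.
right; set L := rcons s w in sL LN cnt.
have uL : uniq L := sorted_uniq ltn_trans ltnn sL.
have szL : size L = k.+1 by rewrite size_rcons sk.
exists (vertices_in N L); split; first by rewrite card_vertices_in // szL addn1.
rewrite (leq_trans cnt) // -size_filter.
set P := (X in filter X _).
rewrite cardE -(size_map (fun z => vertices_in N (omit z L))).
have mem_omit z y : (y \in omit z L) = (y != z) && (y \in L) by rewrite mem_filter.
apply: uniq_leq_size.
  (* Distinct omitted vertices leave distinct edges, since [z] is missing only from its own. *)
  rewrite map_inj_in_uniq ?filter_uniq // => z z'.
  rewrite !mem_filter => /andP[_ zL] /andP[_ z'L] /setP E; apply/eqP.
  have zN : z < N by have := allP LN z zL; rewrite /= mem_iota.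
  have := E (Ordinal zN); rewrite !inE /= !mem_omit eqxx zL andbT /=.
  by case: eqP.
move=> _ /mapP[z + ->]; rewrite mem_filter => /andP[Pz zL].
rewrite mem_enum inE; apply/and3P; split=> //.
  by apply/subsetP => y; rewrite !inE mem_omit => /andP[].
rewrite card_vertices_in ?size_omit ?szL ?filter_uniq //.
by apply/allP => y; rewrite mem_omit => /andP[_ /(allP LN)].
Qed.

(** * Existence of the minimum and the final bound *)

(** Excluded middle replaces decidability of [P]; the clause [r <= N] transfers the upper bound to
    the minimum. *)
Lemma least_nat (P : nat -> Prop) (N : nat) :
  P N -> exists r, [/\ P r, forall M, P M -> r <= M & r <= N].
Proof.
elim/ltn_ind: N => N IH PN.
have [[M [MN PM]]|no] := classic (exists M, M < N /\ P M).
  by have [r [Pr rmin rM]] := IH M MN PM; exists r; split=> //; lia.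
exists N; split=> // M PM; rewrite leqNgt; apply/negP => MN.
by apply: no; exists M.
Qed.

Theorem theorem4 (k : nat) :
  exists c : nat, forall t n : nat, 3 <= t <= k -> k + 1 < n ->
    exists r : nat, is_ramsey_number k (k + 1) t n r /\
      r < twr (t - 2) (c * n ^ (2 * k)).
Proof.
(* Since i <= k, the term 2k^k dominates every 2k^i, uniformly in [t]; the [+ 1] makes the
   inequality strict. *)
exists (2 * k ^ k + 1) => t n /andP[t3 tk] kn.
suff [F uF ltF] : exists2 F, unavoidable k t n F &
    F < twr (t - 2) ((2 * k ^ k + 1) * n ^ (2 * k)).
  have [r [Pr rmin rF]] := least_nat (ramsey_prop_of_unavoidable uF).
  by exists r; split=> //; exact: leq_ltn_trans ltF.
have n0 : 0 < n by lia.
have npos e : 0 < n ^ e by rewrite expn_gt0 n0.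
have lt_c a e : a <= 2 * k ^ k -> e <= 2 * k -> a * n ^ e < (2 * k ^ k + 1) * n ^ (2 * k).
  move=> ac ek; rewrite mulnDl mul1n -addn1 leq_add //.
  by rewrite leq_mul // leq_pexp2l.
case: t t3 tk => [|[|[|[|i]]]] // _ tk.
  exists (n ^ 2); first by rewrite -(subnKC (ltnW tk)) add2n; apply: unavoidable3; lia.
  rewrite -[n ^ 2]mul1n; apply: lt_c; last by lia.
  by rewrite muln_gt0 expn_gt0; lia.
(* Here t = i + 4, and p = k - t + 1 is positive because t <= k. *)
exists (twr i.+2 (2 * k ^ i * n ^ (2 * (k - i.+3 + i.+2)))).
  have := @tower_bound k i (k - i.+3) n; rewrite subnK; last by lia.
  by apply; lia.
rewrite !subSS subn0; apply: ltn_twr; apply: lt_c; last by lia.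
by rewrite leq_mul2l leq_pexp2l //; lia.
Qed.
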